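(* The following two statements are equivalent. (A) For every compact 4-manifold $M$ and every almost complex structure $J$ on $M$ which is tamed by a symplectic form, there is a symplectic form on $M$ compatible with $J$. (B) For every compact almost K\''ahler 4-manifold $(M,g,J,\omega)$ and every $J$-anti-invariant real 2-form $\alpha\in\Omega_J^-$, the almost complex structure $\tilde J_\alpha$ is compatible with a symplectic form on $M$.
   Context: Manifolds and forms are smooth, manifolds are without boundary. A symplectic form $\omega$ tames $J$ if $\omega(u,Ju)>0$ for all nonzero tangent vectors $u$; it is compatible with $J$ if it tames $J$ and $\omega(J\cdot,J\cdot)=\omega(\cdot,\cdot)$. An almost Hermitian structure $(g,J,\omega)$ consists of an almost complex structure $J$, a Riemannian metric $g$ with $g(Ju,Jv)=g(u,v)$, and the 2-form $\omega(u,v)=g(Ju,v)$; it is almost K\''ahler if $d\omega=0$. $\Omega_J^-$ denotes the space of real 2-forms $\alpha$ with $\alpha(J\cdot,J\cdot)=-\alpha(\cdot,\cdot)$. In dimension 4, with the orientation induced by $J$, $\omega$ and every $\alpha\in\Omega_J^-$ are $g$-self-dual and pointwise orthogonal, so $\tilde\omega_\alpha=\omega+\alpha$ is a nowhere vanishing, non-degenerate self-dual form. With point-wise norms normalized so that $|\omega|_g^2=2$, $\tilde J_\alpha$ denotes the $g$-compatible almost complex structure determined by $g(\tilde J_\alpha u,v)=\frac{\sqrt2}{|\tilde\omega_\alpha|_g}\,\tilde\omega_\alpha(u,v)$. *)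

(* Defs.v *)
From HB Require Import structures.
From mathcomp Require Import all_boot all_order all_algebra.
From mathcomp Require Import all_classical all_reals all_analysis.

Set Implicit Arguments.
Unset Strict Implicit.
Unset Printing Implicit Defensive.

Import Order.TTheory GRing.Theory Num.Theory.
Import numFieldNormedType.Exports.

Local Open Scope classical_set_scope.
Local Open Scope ring_scope.

(** Differentiability classes on an open set [U] of R^n. *)

Fixpoint Ck_on (R : realType) (n : nat) (V : normedModType R) (k : nat)
    (U : set 'rV[R]_n) (f : 'rV[R]_n -> V) : Prop :=
  match k with
  | 0%N => forall x, U x -> {for x, continuous f}
  | k'.+1 => (forall x, U x -> differentiable f x) /\
             (forall v : 'rV[R]_n, Ck_on k' U (fun x => 'D_v f x))
  end.

Definition smooth_on (R : realType) (n : nat) (V : normedModType R)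
    (U : set 'rV[R]_n) (f : 'rV[R]_n -> V) : Prop :=
  forall k, Ck_on k U f.

(** Smooth manifolds without boundary. *)

(* A homeomorphism from the open set [cdom] of [T] onto the open set [cimg] of
   R^n.  [cmap] and [cinv] are total functions, but their values outside
   [cdom] and [cimg] are irrelevant. *)
Record chart (R : realType) (n : nat) (T : topologicalType) := Chart {
  cdom : set T;
  cimg : set 'rV[R]_n;
  cmap : T -> 'rV[R]_n;
  cinv : 'rV[R]_n -> T;
  cdom_open : open cdom;
  cimg_open : open cimg;
  cmap_img : forall p, cdom p -> cimg (cmap p);
  cinv_dom : forall x, cimg x -> cdom (cinv x);
  cmapK : forall p, cdom p -> cinv (cmap p) = p;
  cinvK : forall x, cimg x -> cmap (cinv x) = x;
  cmap_continuous : forall p, cdom p -> {for p, continuous cmap};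
  cinv_continuous : forall x, cimg x -> {for x, continuous cinv}
}.

(* [c2 o c1^-1] is smooth where it is defined. *)
Definition smooth_transition (R : realType) (n : nat) (T : topologicalType)
    (c1 c2 : chart R n T) : Prop :=
  smooth_on (cimg c1 `&` cinv c1 @^-1` cdom c2) (cmap c2 \o cinv c1).

Record manifold (R : realType) (n : nat) := Manifold {
  points :> topologicalType;
  mfd_hausdorff : hausdorff_space points;
  mfd_second_countable : @second_countable points;
  atlas : set (chart R n points);
  atlas_cover : forall p, exists2 c, atlas c & cdom c p;
  atlas_smooth : forall c1 c2,
    atlas c1 -> atlas c2 -> smooth_transition c1 c2
}.

(** Tangent spaces and tensor fields.

    At each point [p] a chart of the atlas is singled out, and the tangent
    space T_pM is identified with ['rV[R]_n] through it.  This choice need not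
    depend continuously on [p]: smoothness of tensor fields is tested on their
    components in the coordinate frames of the charts of the atlas, obtained by
    change of basis from the identification above.

    Tangent vectors are row vectors, an endomorphism [A] acts by
    [u |-> u *m A], and a bilinear form is represented by its Gram matrix. *)

Definition chart_at (R : realType) (n : nat) (M : manifold R n) (p : M) :
    chart R n M :=
  s2val (cid2 (@atlas_cover R n M p)).

(* The rows are the coordinate vectors of the chart [c] at [p], seen in the
   identification of T_pM with ['rV[R]_n] given by [chart_at p]. *)
Definition coord_frame (R : realType) (n : nat) (M : manifold R n)
    (c : chart R n M) (p : M) : 'M[R]_n :=
  'J (cmap (chart_at p) \o cinv c) (cmap c p).

(* Fields of endomorphisms of the tangent spaces, resp. of bilinear forms on
   them; they are kept apart since their components transform differently. *)
Definition endo_field (R : realType) (n : nat) (M : manifold R n) : Type :=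
  M -> 'M[R]_n.

Definition bilin_field (R : realType) (n : nat) (M : manifold R n) : Type :=
  M -> 'M[R]_n.

Definition bilin (R : realType) (n : nat) (B : 'M[R]_n) (u v : 'rV[R]_n) : R :=
  (u *m B *m v^T) ord0 ord0.

Definition endo_comp (R : realType) (n : nat) (M : manifold R n)
    (A : endo_field M) (c : chart R n M) (x : 'rV[R]_n) : 'M[R]_n :=
  let P := coord_frame c (cinv c x) in P *m A (cinv c x) *m invmx P.

Definition bilin_comp (R : realType) (n : nat) (M : manifold R n)
    (B : bilin_field M) (c : chart R n M) (x : 'rV[R]_n) : 'M[R]_n :=
  let P := coord_frame c (cinv c x) in P *m B (cinv c x) *m P^T.

Definition smooth_endo (R : realType) (n : nat) (M : manifold R n)
    (A : endo_field M) : Prop :=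
  forall c, atlas c -> smooth_on (cimg c) (endo_comp A c).

Definition smooth_bilin (R : realType) (n : nat) (M : manifold R n)
    (B : bilin_field M) : Prop :=
  forall c, atlas c -> smooth_on (cimg c) (bilin_comp B c).

(** Differential forms of degree 2. *)

Definition two_form (R : realType) (n : nat) (M : manifold R n)
    (w : bilin_field M) : Prop :=
  smooth_bilin w /\ (forall (p : M) (u : 'rV[R]_n), bilin (w p) u u = 0).

(* [(dw)_ijk = d_i w_jk + d_j w_ki + d_k w_ij] in the coordinates of [c]. *)
Definition ext_deriv (R : realType) (n : nat) (M : manifold R n)
    (w : bilin_field M) (c : chart R n M) (x : 'rV[R]_n) (i j k : 'I_n) : R :=
  let partial (a b l : 'I_n) : R :=
    'D_(delta_mx ord0 a : 'rV[R]_n) (fun y => bilin_comp w c y b l) x in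
  partial i j k + partial j k i + partial k i j.

Definition closed_form (R : realType) (n : nat) (M : manifold R n)
    (w : bilin_field M) : Prop :=
  forall c, atlas c -> forall x, cimg c x ->
  forall i j k, ext_deriv w c x i j k = 0.

Definition symplectic (R : realType) (n : nat) (M : manifold R n)
    (w : bilin_field M) : Prop :=
  [/\ two_form w, closed_form w &
      forall (p : M) (u : 'rV[R]_n),
        (forall v, bilin (w p) u v = 0) -> u = 0].

(** Almost complex and almost Hermitian structures. *)

Definition almost_complex (R : realType) (n : nat) (M : manifold R n)
    (J : endo_field M) : Prop :=
  smooth_endo J /\ (forall (p : M) (u : 'rV[R]_n), u *m J p *m J p = - u).

Definition tames (R : realType) (n : nat) (M : manifold R n)
    (w : bilin_field M) (J : endo_field M) : Prop :=
  forall (p : M) (u : 'rV[R]_n), u != 0 -> 0 < bilin (w p) u (u *m J p).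

Definition compatible (R : realType) (n : nat) (M : manifold R n)
    (w : bilin_field M) (J : endo_field M) : Prop :=
  tames w J /\
  (forall (p : M) (u v : 'rV[R]_n),
     bilin (w p) (u *m J p) (v *m J p) = bilin (w p) u v).

Definition riemannian (R : realType) (n : nat) (M : manifold R n)
    (g : bilin_field M) : Prop :=
  [/\ smooth_bilin g,
      forall (p : M) (u v : 'rV[R]_n), bilin (g p) u v = bilin (g p) v u &
      forall (p : M) (u : 'rV[R]_n), u != 0 -> 0 < bilin (g p) u u].

Definition almost_hermitian (R : realType) (n : nat) (M : manifold R n)
    (g : bilin_field M) (J : endo_field M) (w : bilin_field M) : Prop :=
  [/\ almost_complex J, riemannian g,
      forall (p : M) (u v : 'rV[R]_n),
        bilin (g p) (u *m J p) (v *m J p) = bilin (g p) u v,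
      two_form w &
      forall (p : M) (u v : 'rV[R]_n),
        bilin (w p) u v = bilin (g p) (u *m J p) v].

Definition almost_kahler (R : realType) (n : nat) (M : manifold R n)
    (g : bilin_field M) (J : endo_field M) (w : bilin_field M) : Prop :=
  almost_hermitian g J w /\ closed_form w.

(* Membership in the space [Omega_J^-]. *)
Definition anti_invariant (R : realType) (n : nat) (M : manifold R n)
    (J : endo_field M) (a : bilin_field M) : Prop :=
  two_form a /\
  (forall (p : M) (u v : 'rV[R]_n),
     bilin (a p) (u *m J p) (v *m J p) = - bilin (a p) u v).

(* Norm on 2-forms induced by the inner product [g]: in index notation
   [|a|^2 = 1/2 g^ik g^jl a_ij a_kl].  The factor 1/2 gives norm [sqrt 2] to
   fundamental forms of almost Hermitian structures in dimension 4, see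
   [form_norm_fundamental]. *)
Definition form_norm (R : realType) (n : nat) (g a : 'M[R]_n) : R :=
  Num.sqrt (2^-1 * \tr (invmx g *m a *m invmx g *m a^T)).

Lemma form_norm_fundamental (R : realType) (g J : 'M[R]_4) :
  g \in unitmx -> g^T = g -> J *m g *m J^T = g ->
  form_norm g (J *m g) ^+ 2 = 2.
Proof.
move=> gU gT gJ; rewrite /form_norm trmx_mul gT -mulmxA.
have -> : invmx g *m (J *m g) *m (invmx g *m (g *m J^T)) = 1%:M.
  by rewrite mulKmx // -!mulmxA (mulmxA J) gJ mulVmx.
rewrite mxtrace_scalar sqr_sqrtr; last by rewrite mulr_ge0 ?invr_ge0 ?ler0n.
by rewrite (_ : 1 *+ 4 = 2 * 2) ?mulKf ?pnatr_eq0 // -natrM.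
Qed.

(* The identity determining the endomorphism field [Jt] from [g] and the
   nowhere vanishing form [w + a]. *)
Definition is_tilde_J (R : realType) (M : manifold R 4)
    (g w a : bilin_field M) (Jt : endo_field M) : Prop :=
  forall (p : M) (u v : 'rV[R]_4),
    bilin (g p) (u *m Jt p) v =
    Num.sqrt 2 / form_norm (g p) (w p + a p) * bilin (w p + a p) u v.

(* Main.v *)
Require Import Defs.
From mathcomp Require Import all_boot all_order all_algebra.
From mathcomp Require Import all_classical all_reals all_analysis.
From mathcomp Require Import ring lra.

Set Implicit Arguments.
Unset Strict Implicit.
Unset Printing Implicit Defensive.

Import Order.TTheory GRing.Theory Num.Theory.
Import numFieldNormedType.Exports.

Local Open Scope classical_set_scope.
Local Open Scope ring_scope.

(** Both statements speak about the same almost complex structures: on a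
    4-manifold, the structures tamed by a symplectic form are exactly the
    structures [Jt] obtained from an almost Kähler structure [(g, J, w)] and a
    form [a] in [Omega_J^-].  Once this is known, each statement is the other
    one read through this identification, manifold by manifold.

    One inclusion is [tilde_J_tamed]: the symplectic form [w] itself tames [Jt].
    Since [a(u, Ju) = 0], one finds [w(u, Jt u) = c g(u, u)], where
    [c = sqrt 2 / |w + a|_g].  It has also to be seen that [Jt] squares to [-1].
    Let [K] be the endomorphism with [g(Ku, v) = a(u, v)]; then
    [Jt = c (J + K)].  As [K] is skew and anticommutes with [J], and as the
    dimension is 4, [K^2] is a nonpositive scalar [-l]
    ([anticommuting_skew_sqr]), so that [(J + K)^2 = -(1 + l)], while
    [|w + a|_g^2 = 2 (1 + l)].

    The other inclusion is [tamed_is_tilde_J].  Let the symplectic form [w] tame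
    [J].  The [J]-invariant part of [w] is the fundamental form of a
    [J]-Hermitian metric [g0], and the rest of [w] lies in [Omega_J^-]; hence
    [w] determines a second [g0]-orthogonal almost complex structure
    [T = c (J + K)] with [c = sqrt 2 / |w|_g0].  For the conformal metric
    [g = c^-1 g0] the fundamental form of [T] is [w], so [(g, T, w)] is almost
    Kähler.  The form [a(u, v) = c^-1 g(Ju, v) - w(u, v)] is [T]-anti-invariant
    because [JT + TJ = -2c], and [w + a] is a positive multiple of [g(Ju, v)],
    so the structure that [w + a] determines is [J] again.

    Both arguments are pointwise linear algebra, apart from the smoothness of
    the fields involved.  This is checked on components: in the coordinates of a
    chart they are obtained from smooth components by matrix operations and by
    the square root of a positive function, because change of frame is
    invertible ([coord_frame_unit]). *)

(** * Bilinear forms and Gram matrices *)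

Section BilinearForms.
Variables (R : realType) (n : nat).
Implicit Types (A B G : 'M[R]_n) (u v w : 'rV[R]_n) (a : R).

Lemma bilin_inj A B : (forall u v, bilin A u v = bilin B u v) -> A = B.
Proof.
move=> AB; apply/matrixP => i j.
have := AB (delta_mx 0 i) (delta_mx 0 j).
by rewrite /bilin -!rowE !trmx_delta -!colE !mxE.
Qed.

Lemma bilin_mul A B G u v :
  bilin G (u *m A) (v *m B) = bilin (A *m G *m B^T) u v.
Proof. by rewrite /bilin trmx_mul !mulmxA. Qed.

Lemma bilin_mull A G u v : bilin G (u *m A) v = bilin (A *m G) u v.
Proof. by rewrite /bilin !mulmxA. Qed.

Lemma bilin_mulr A G u v : bilin G u (v *m A) = bilin (G *m A^T) u v.
Proof. by rewrite /bilin trmx_mul !mulmxA. Qed.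

Lemma bilinD A B u v : bilin (A + B) u v = bilin A u v + bilin B u v.
Proof. by rewrite /bilin mulmxDr mulmxDl mxE. Qed.

Lemma bilinZ a A u v : bilin (a *: A) u v = a * bilin A u v.
Proof. by rewrite /bilin -scalemxAr -scalemxAl mxE. Qed.

Lemma bilinN A u v : bilin (- A) u v = - bilin A u v.
Proof. by rewrite -scaleN1r bilinZ mulN1r. Qed.

Lemma bilinDr A u v w : bilin A u (v + w) = bilin A u v + bilin A u w.
Proof. by rewrite /bilin linearD mulmxDr mxE. Qed.

Lemma bilinDl A u v w : bilin A (u + v) w = bilin A u w + bilin A v w.
Proof. by rewrite /bilin !mulmxDl mxE. Qed.

Lemma bilinZr A a u v : bilin A u (a *: v) = a * bilin A u v.
Proof. by rewrite /bilin linearZ -scalemxAr mxE. Qed.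

Lemma bilinNr A u v : bilin A u (- v) = - bilin A u v.
Proof. by rewrite -scaleN1r bilinZr mulN1r. Qed.

Lemma bilin_tr A u v : bilin A^T u v = bilin A v u.
Proof.
by rewrite /bilin -[v *m A *m u^T]trmxK [RHS]mxE !trmx_mul trmxK mulmxA.
Qed.

Lemma alternatingP A : (forall u, bilin A u u = 0) <-> A^T = - A.
Proof.
split=> [A0|AT u].
  apply: bilin_inj => u v; rewrite bilin_tr bilinN.
  have := A0 (u + v); rewrite bilinDr !bilinDl !A0 add0r addr0 => /eqP.
  by rewrite addr_eq0 => /eqP ->.
have := bilin_tr A u u; rewrite AT bilinN => /eqP.
by rewrite eqNr => /eqP.
Qed.

Definition posdef G := forall u, u != 0 -> 0 < bilin G u u.

Lemma posdef_eq0 G u : posdef G -> bilin G u u = 0 -> u = 0.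
Proof. by move=> Gpos; have [//|/Gpos/gt_eqF/eqP] := eqVneq u 0. Qed.

(** A vector of the kernel is isotropic, hence zero. *)
Lemma posdef_unit G : posdef G -> G \in unitmx.
Proof.
move=> Gpos; rewrite -row_free_unit -kermx_eq0; apply/eqP/row_matrixP => i.
rewrite row0; apply: (posdef_eq0 Gpos).
by rewrite /bilin -row_mul mulmx_ker row0 mul0mx mxE.
Qed.

(** The Gram matrix of the rows is diagonal with positive entries. *)
Lemma orthogonal_unitmx G (P : 'M[R]_n) : posdef G ->
  (forall i, row i P != 0) ->
  (forall i j, i != j -> bilin G (row i P) (row j P) = 0) -> P \in unitmx.
Proof.
move=> Gpos P0 Portho.
have : P *m (G *m P^T) \in unitmx.
  suff -> : P *m (G *m P^T) = diag_mx (\row_i bilin G (row i P) (row i P)).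
    rewrite unitmxE det_diag unitfE prodf_seq_neq0; apply/allP => i _ /=.
    by rewrite mxE gt_eqF // Gpos.
  apply/matrixP => i j; rewrite mulmxA [RHS]mxE [in RHS]mxE.
  have -> : (P *m G *m P^T) i j = bilin G (row i P) (row j P).
    by rewrite /bilin -row_mul !mxE; apply: eq_bigr => k _; rewrite !mxE.
  by have [->|/Portho->] := eqVneq i j; rewrite ?mulr1n ?mulr0n.
by rewrite unitmx_mul => /andP[].
Qed.

End BilinearForms.

(** * Hermitian linear algebra at a point *)

Section HermitianLinearAlgebra.
Variables (R : realType).

Record hermitian_at n (G J : 'M[R]_n) : Prop := Hermitian {
  herm_sym : G^T = G;
  herm_pos : posdef G;
  herm_sqr : J *m J = - 1%:M;
  herm_iso : J *m G *m J^T = G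
}.

(** The condition that defines [Omega_J^-] at a point. *)
Definition anti_herm n (J a : 'M[R]_n) : Prop :=
  a^T = - a /\ J *m a *m J^T = - a.

Section AnyDimension.
Variables (n : nat) (G J : 'M[R]_n).
Hypothesis GJ : hermitian_at G J.

Let GU : G \in unitmx := posdef_unit (herm_pos GJ).

(** An isometry with square [-1] is skew-adjoint. *)
Lemma hermitian_adj : G *m J^T = - (J *m G).
Proof.
rewrite -[in RHS](herm_iso GJ) !mulmxA (herm_sqr GJ).
by rewrite !mulNmx mul1mx opprK.
Qed.

Lemma fundamental_skew : (J *m G)^T = - (J *m G).
Proof. by rewrite trmx_mul (herm_sym GJ) hermitian_adj. Qed.

Lemma anti_herm_commute (a : 'M[R]_n) : anti_herm J a ->
  J *m (a *m invmx G) = - (a *m invmx G *m J).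
Proof.
move=> [_ aJ].
have aJT : a *m J^T = J *m a.
  apply: oppr_inj; rewrite -[RHS]mulmxN -aJ !mulmxA (herm_sqr GJ).
  by rewrite !mulNmx mul1mx.
have GJV : J^T *m invmx G = - (invmx G *m J).
  rewrite -[J^T](mulKmx GU) hermitian_adj mulmxN mulNmx.
  by rewrite -!mulmxA mulmxV // mulmx1.
by rewrite mulmxA -aJT -mulmxA GJV mulmxN mulmxA.
Qed.

End AnyDimension.

(** Unless [K = 0], choose [u] with [uK != 0].  Skewness and anticommutation
    make [u, uJ, uK, uKJ] pairwise orthogonal, so in dimension 4 they form a
    basis.  The vector [uK^2] is orthogonal to the last three of them, whence
    [uK^2 = - l u], and the equation spreads to the whole basis because [K^2]
    commutes with [J] and [K]. *)
Lemma anticommuting_skew_sqr (G J K : 'M[R]_4) :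
  hermitian_at G J -> (K *m G)^T = - (K *m G) -> J *m K = - (K *m J) ->
  exists2 l, 0 <= l & K *m K = - l%:M.
Proof.
move=> GJ KG JK.
have [->|K0] := eqVneq K 0.
  by exists 0 => //; rewrite mulmx0 raddf0 oppr0.
have [i rK0] : exists i, row i K != 0.
  apply/existsP; apply: contra_neqT K0; rewrite negb_exists => /forallP rK0.
  by apply/row_matrixP => i; rewrite row0; have /negPn/eqP := rK0 i.
pose u : 'rV[R]_4 := delta_mx 0 i.
have uK0 : u *m K != 0 by rewrite -rowE.
have u0 : u != 0 by apply: contra_neq uK0 => ->; rewrite mul0mx.
pose d (x y : 'rV[R]_4) := bilin G x y.
have dNr x y : d x (- y) = - d x y by exact: bilinNr.
have dDr x y z : d x (y + z) = d x y + d x z by exact: bilinDr.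
have dZr x a y : d x (a *: y) = a * d x y by exact: bilinZr.
have dC x y : d x y = d y x by rewrite /d -bilin_tr (herm_sym GJ).
have dJ x y : d (x *m J) (y *m J) = d x y by rewrite /d bilin_mul (herm_iso GJ).
have dK x y : d (x *m K) y = - d x (y *m K).
  rewrite /d bilin_mull bilin_mulr -bilinN -[K *m G]opprK -KG trmx_mul.
  by rewrite (herm_sym GJ).
have xJJ (x : 'rV[R]_4) : x *m J *m J = - x.
  by rewrite -mulmxA (herm_sqr GJ) mulmxN mulmx1.
have xJK (x : 'rV[R]_4) : x *m J *m K = - (x *m K *m J).
  by rewrite -!mulmxA JK mulmxN.
have dxJ x : d x (x *m J) = 0.
  rewrite /d bilin_mulr (hermitian_adj GJ); move: x; apply/alternatingP.
  by rewrite linearN /= (fundamental_skew GJ).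
have dxK x : d x (x *m K) = 0.
  have := dK x x; rewrite dC => /eqP; rewrite -subr_eq0 opprK -mulr2n.
  by rewrite mulrn_eq0 => /eqP.
(* The three pairings of [x] with its images give all six orthogonality
   relations, applied to [u] and to [uK]. *)
have dxKJ x : d x (x *m K *m J) = 0.
  have : d x (x *m K *m J) = - d x (x *m K *m J).
    rewrite -[in LHS](opprK (x *m K *m J)) -xJK dNr -dK.
    by rewrite -dJ xJJ dNr dC.
  by move/eqP; rewrite -addr_eq0 -mulr2n mulrn_eq0 => /eqP.
pose l := d (u *m K) (u *m K) / d u u.
have du : 0 < d u u by exact: herm_pos GJ _ u0.
have duK : 0 < d (u *m K) (u *m K) by exact: herm_pos GJ _ uK0.
exists l; first by rewrite divr_ge0 // ltW.
pose e := [:: u; u *m J; u *m K; u *m K *m J].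
pose P : 'M[R]_4 := \matrix_(k < 4) e`_k.
have PU : P \in unitmx.
  apply: (orthogonal_unitmx (herm_pos GJ)) => [k|k1 k2].
    have XJ0 (x : 'rV[R]_4) : x != 0 -> x *m J != 0.
      apply: contra_neq => xJ; have /esym/eqP := xJJ x.
      by rewrite xJ mul0mx oppr_eq0 => /eqP.
    by rewrite rowK; case: k => [[|[|[|[|]]]]] //= _; rewrite ?XJ0.
  rewrite !rowK -/(d _ _).
  wlog lt12 : k1 k2 / (k1 < k2)%N => [H|].
    rewrite neq_ltn => /orP[] lt; [|rewrite dC]; apply: H => //;
      by rewrite neq_ltn lt.
  move=> _; move: lt12.
  case: k1 => [[|[|[|[|]]]]] //= _; case: k2 => [[|[|[|[|]]]]] //= _ _.
  - by rewrite dC -dJ xJJ dNr dC dxKJ oppr0.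
  - by rewrite dJ.
(* [uKK] settles the first row of [P], [comJ] and [comK] the others. *)
suff PK : P *m (K *m K + l%:M) = 0.
  apply/eqP; rewrite -addr_eq0 -[_ + _](mulKmx PU) PK mulmx0 //.
have uKK : u *m (K *m K + l%:M) = 0.
  pose x := u *m K *m K + l *: u.
  have -> : u *m (K *m K + l%:M) = x by rewrite mulmxDr mulmxA mul_mx_scalar.
  suff : P *m (G *m x^T) = 0.
    move=> Px; apply: (posdef_eq0 (herm_pos GJ)).
    by rewrite /bilin -mulmxA -[G *m _](mulKmx PU) Px !mulmx0 mxE.
  apply/matrixP => k j; rewrite ord1 mulmxA [RHS]mxE.
  have -> : (P *m G *m x^T) k 0 = d e`_k x.
    have -> : e`_k = row k P by rewrite rowK.
    by rewrite /d /bilin -row_mul -row_mul [RHS]mxE.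
  rewrite dDr dZr.
  case: k => [[|[|[|[|]]]]] //= _.
  - by rewrite -[d u _]opprK -dK divfK ?gt_eqF // addrC subrr.
  - rewrite -[d (u *m J) (_ *m K)]opprK -dK xJK dC dNr dxJ (dC _ u) dxJ.
    by rewrite mulr0 !oppr0 addr0.
  - by rewrite dxK (dC _ u) dxK mulr0 addr0.
  - by rewrite dC dK xJK dNr dxKJ (dC _ u) dxKJ mulr0 !oppr0 addr0.
have comJ : J *m (K *m K + l%:M) = (K *m K + l%:M) *m J.
  rewrite mulmxDr mulmxDl scalar_mxC mulmxA JK mulNmx.
  by rewrite -(mulmxA K J K) JK mulmxN opprK mulmxA.
have comK : K *m (K *m K + l%:M) = (K *m K + l%:M) *m K.
  by rewrite mulmxDr mulmxDl !mulmxA scalar_mxC.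
apply/row_matrixP => k; rewrite row0 row_mul rowK.
case: k => [[|[|[|[|]]]]] //= _.
- by rewrite -mulmxA comJ mulmxA uKK mul0mx.
- by rewrite -mulmxA comK mulmxA uKK mul0mx.
- by rewrite -!mulmxA comJ (mulmxA K) comK !mulmxA uKK !mul0mx.
Qed.

Definition tilde_factor (G W : 'M[R]_4) : R := Num.sqrt 2 / form_norm G W.

(** The solution [T] of
    [bilin G (u *m T) v = tilde_factor G W * bilin W u v]. *)
Definition tilde_endo (G W : 'M[R]_4) : 'M[R]_4 :=
  tilde_factor G W *: (W *m invmx G).

Lemma tilde_endo_mul (G W : 'M[R]_4) : G \in unitmx ->
  tilde_endo G W *m G = tilde_factor G W *: W.
Proof. by move=> GU; rewrite -scalemxAl mulmxKV. Qed.

Section TildeEndo.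
Variables (G J a : 'M[R]_4).
Hypotheses (GJ : hermitian_at G J) (aJ : anti_herm J a).

Let GU : G \in unitmx := posdef_unit (herm_pos GJ).
Let K := a *m invmx G.
Let W := J *m G + a.
Let c := tilde_factor G W.

Lemma tilde_form_skew : W^T = - W.
Proof. by rewrite linearD /= (fundamental_skew GJ) aJ.1 opprD. Qed.

Lemma mul_form_invmx : W *m invmx G = J + K.
Proof. by rewrite mulmxDl mulmxK. Qed.

(** The norm is read off from the square: with [V] the inverse of [G], the
    skewness of [W] gives
    [|W|^2 = - 1/2 tr (V W V W) = - 1/2 tr ((J + K)^2)]. *)
Lemma tilde_sqr : exists2 l, 0 <= l &
  (J + K) *m (J + K) = - (1 + l)%:M /\ form_norm G W = Num.sqrt (2 * (1 + l)).
Proof.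
have KG : K *m G = a by rewrite mulmxKV.
have JK : J *m K = - (K *m J) := anti_herm_commute GJ aJ.
have [l l0 KK] : exists2 l, 0 <= l & K *m K = - l%:M.
  by apply: (anticommuting_skew_sqr GJ) => //; rewrite KG aJ.1.
have sqr : (J + K) *m (J + K) = - (1 + l)%:M.
  rewrite mulmxDl !mulmxDr (herm_sqr GJ) KK JK.
  by rewrite -addrA addKr raddfD opprD.
exists l => //; split=> //; rewrite /form_norm tilde_form_skew; congr Num.sqrt.
rewrite mulmxN linearN /= mxtrace_mulC !mulmxA mul_form_invmx.
rewrite -mulmxA mul_form_invmx sqr linearN /= opprK mxtrace_scalar -mulr_natl.
by field.
Qed.

Lemma tilde_norm_gt0 : 0 < form_norm G W.
Proof.
by have [l l0 [_ ->]] := tilde_sqr; rewrite sqrtr_gt0 mulr_gt0 // ltr_wpDr.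
Qed.

Lemma tilde_factor_gt0 : 0 < c.
Proof. by rewrite divr_gt0 ?tilde_norm_gt0 // sqrtr_gt0. Qed.

Lemma tilde_endoE : tilde_endo G W = c *: (J + K).
Proof. by rewrite /tilde_endo mul_form_invmx. Qed.

Lemma tilde_hermitian : hermitian_at G (tilde_endo G W).
Proof.
have TT : tilde_endo G W *m tilde_endo G W = - 1%:M.
  rewrite tilde_endoE -scalemxAl -scalemxAr scalerA.
  have [l l0 [-> nE]] := tilde_sqr.
  have l1 : 0 < 1 + l by rewrite ltr_wpDr.
  rewrite scalerN scale_scalar_mx; congr (- _%:M).
  rewrite -expr2 /c /tilde_factor nE expr_div_n !sqr_sqrtr ?mulr_ge0 ?ltW //.
  by field; rewrite gt_eqF.
split; [exact: herm_sym GJ|exact: herm_pos GJ|exact: TT|].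
have TG : G *m (tilde_endo G W)^T = - (tilde_endo G W *m G).
  rewrite -[X in X *m _](herm_sym GJ) -trmx_mul (tilde_endo_mul W GU).
  by rewrite linearZ /= tilde_form_skew scalerN.
by rewrite -mulmxA TG mulmxN mulmxA TT mulNmx mul1mx opprK.
Qed.

(** With [J G] the fundamental form, the value is [c] times
    [bilin G u u - bilin (J *m a) u u], and [J *m a] is skew. *)
Lemma fundamental_tames u :
  u != 0 -> 0 < bilin (J *m G) u (u *m tilde_endo G W).
Proof.
move=> u0; rewrite bilin_mulr /tilde_endo linearZ /= -scalemxAr bilinZ.
rewrite mulr_gt0 ?tilde_factor_gt0 // trmx_mul trmx_inv (herm_sym GJ).
rewrite tilde_form_skew mulmxA mulmxK // mulmxN mulmxDr mulmxA (herm_sqr GJ).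
rewrite mulNmx mul1mx opprD opprK bilinD bilinN.
rewrite (alternatingP (J *m a)).2 ?subr0 ?(herm_pos GJ) //.
rewrite trmx_mul aJ.1 mulNmx; congr (- _).
apply: oppr_inj; rewrite -[RHS]mulmxN -aJ.2 !mulmxA (herm_sqr GJ).
by rewrite !mulNmx mul1mx.
Qed.

Lemma tilde_anticommutator :
  J *m tilde_endo G W + tilde_endo G W *m J = - (2 * c)%:M.
Proof.
rewrite tilde_endoE -scalemxAr -scalemxAl -scalerDr mulmxDr mulmxDl.
rewrite (anti_herm_commute GJ aJ) (herm_sqr GJ) addrACA addNr addr0.
by rewrite -opprD -raddfD /= scalerN scale_scalar_mx mulrC.
Qed.

End TildeEndo.

Lemma hermitian_scale n (G J : 'M[R]_n) b :
  0 < b -> hermitian_at G J -> hermitian_at (b *: G) J.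
Proof.
move=> b0 [GT Gpos JJ GJ]; split=> // [|u u0|].
- by rewrite linearZ /= GT.
- by rewrite bilinZ mulr_gt0 // Gpos.
- by rewrite -scalemxAr -scalemxAl GJ.
Qed.

(** When [W] tames [J], this is the metric [1/2 (W(u, Jv) - W(Ju, v))], for
    which the fundamental form of [J] is the [J]-invariant part of [W]. *)
Definition taming_metric n (J W : 'M[R]_n) : 'M[R]_n :=
  2^-1 *: (W *m J^T - J *m W).

Definition anti_part n (J W : 'M[R]_n) : 'M[R]_n :=
  2^-1 *: (W - J *m W *m J^T).

Section Taming.
Variables (n : nat) (J W : 'M[R]_n).
Hypotheses (JJ : J *m J = - 1%:M) (WT : W^T = - W).

Let JTJT : J^T *m J^T = - 1%:M.
Proof. by rewrite -trmx_mul JJ linearN /= trmx1. Qed.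

Lemma taming_metric_hermitian :
  (forall u : 'rV[R]_n, u != 0 -> 0 < bilin W u (u *m J)) ->
  hermitian_at (taming_metric J W) J.
Proof.
move=> WJ; split=> //.
- rewrite /taming_metric linearZ linearB /= !trmx_mul trmxK WT.
  by rewrite mulmxN mulNmx opprK addrC.
- move=> u u0; rewrite bilinZ bilinD bilinN -bilin_mulr -bilin_mull.
  rewrite -(bilin_tr W u) WT bilinN opprK.
  by have := WJ u u0; lra.
- rewrite -scalemxAr -scalemxAl; congr (_ *: _).
  rewrite mulmxBr mulmxBl !mulmxA JJ -!mulmxA JTJT !mulmxN !mulNmx.
  by rewrite !mul1mx mulmx1 opprK addrC.
Qed.

Lemma anti_part_anti_herm : anti_herm J (anti_part J W).
Proof.
split.
  rewrite /anti_part linearZ linearB /= !trmx_mul trmxK WT -scalerN.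
  by rewrite mulNmx mulmxN opprB opprK mulmxA addrC.
rewrite -scalemxAr -scalemxAl -scalerN; congr (_ *: _).
rewrite mulmxBr mulmxBl !mulmxA JJ -!mulmxA JTJT !mulmxN !mulNmx !mul1mx mulmx1.
by rewrite opprK opprB.
Qed.

Lemma taming_split : J *m taming_metric J W + anti_part J W = W.
Proof.
rewrite -scalemxAr -scalerDr mulmxBr !mulmxA JJ mulNmx mul1mx opprK.
rewrite (addrC W) addrACA subrr add0r scalerDr -scalerDl.
by have -> : 2^-1 + 2^-1 = 1 :> R; [field|rewrite scale1r].
Qed.

End Taming.

Lemma form_norm_scale (G : 'M[R]_4) J b : 0 <= b -> hermitian_at G J ->
  form_norm G (b *: (J *m G)) = b * Num.sqrt 2.
Proof.
move=> b0 GJ; have GU := posdef_unit (herm_pos GJ).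
have nE : form_norm G (J *m G) = Num.sqrt 2.
  rewrite -(form_norm_fundamental GU (herm_sym GJ) (herm_iso GJ)).
  by rewrite sqrtr_sqr ger0_norm // sqrtr_ge0.
rewrite -nE /form_norm [(_ *: _)^T]linearZ /= -!scalemxAr -!scalemxAl scalerA.
by rewrite linearZ /= mulrCA -expr2 sqrtrM ?sqr_ge0 // sqrtr_sqr ger0_norm.
Qed.

(** Here [W] tames [J], the metric [G0] is [taming_metric J W], and [T] is the
    orthogonal complex structure of [G0] determined by [W]; passing from [G0] to
    the conformal metric [G] turns [W] into the fundamental form of [T]. *)
Section Retaming.
Variables (J W : 'M[R]_4).
Hypotheses (JJ : J *m J = - 1%:M) (WT : W^T = - W).
Hypothesis WJ : forall u : 'rV[R]_4, u != 0 -> 0 < bilin W u (u *m J).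

Let G0 := taming_metric J W.
Let c := tilde_factor G0 W.
Let T := tilde_endo G0 W.
Let G := c^-1 *: G0.
Let a := c^-1 *: (J *m G) - W.

Let GJ0 : hermitian_at G0 J := taming_metric_hermitian JJ WT WJ.
Let aJ0 : anti_herm J (anti_part J W) := anti_part_anti_herm JJ WT.
Let splitW : J *m G0 + anti_part J W = W := taming_split W JJ.

Lemma retaming_factor_gt0 : 0 < c.
Proof. by have := tilde_factor_gt0 GJ0 aJ0; rewrite splitW. Qed.

Lemma retaming_hermitian : hermitian_at G T.
Proof.
apply: hermitian_scale; first by rewrite invr_gt0 retaming_factor_gt0.
by have := tilde_hermitian GJ0 aJ0; rewrite splitW.
Qed.

Lemma retaming_hermitian0 : hermitian_at G J.
Proof. by apply: hermitian_scale; rewrite // invr_gt0 retaming_factor_gt0. Qed.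

Lemma retaming_fundamental : T *m G = W.
Proof.
rewrite -scalemxAr /T tilde_endo_mul ?(posdef_unit (herm_pos GJ0)) //.
by rewrite scalerA mulVf ?scale1r // gt_eqF // retaming_factor_gt0.
Qed.

(** From [JT + TJ = -2c] one gets [T (JG) T^T = 2c W - JG], and [T W T^T = W];
    the coefficient [c^-1] of [JG] in [a] is the one for which [a] changes
    sign. *)
Lemma retaming_anti_herm : anti_herm T a.
Proof.
split.
  rewrite linearB linearZ /= (fundamental_skew retaming_hermitian0) WT.
  by rewrite scalerN opprB opprK addrC.
have JT : J *m T = - (2 * c)%:M - T *m J.
  have := tilde_anticommutator GJ0 aJ0; rewrite splitW => <-.
  by rewrite addrK.
have TT := herm_sqr retaming_hermitian.
have TGT := hermitian_adj retaming_hermitian.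
have WTT : W *m T^T = G.
  by rewrite -retaming_fundamental (herm_iso retaming_hermitian).
rewrite /a mulmxBr mulmxBl -(mulmxA T W) WTT retaming_fundamental.
rewrite -scalemxAr -scalemxAl -!mulmxA TGT !mulmxN (mulmxA J) JT.
rewrite mulmxBl mulNmx mul_scalar_mx mulmxBr mulmxN -scalemxAr.
rewrite retaming_fundamental !mulmxA TT !mulNmx !mul1mx opprK opprD opprK.
rewrite scalerBr scalerA.
have -> : c^-1 * (2 * c) = 1 + 1.
  by field; rewrite gt_eqF // retaming_factor_gt0.
by rewrite scalerDl !scale1r opprB addrAC addrK.
Qed.

Lemma retaming_tilde u v :
  bilin G (u *m J) v = Num.sqrt 2 / form_norm G (W + a) * bilin (W + a) u v.
Proof.
have c0 := retaming_factor_gt0.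
rewrite /a addrC subrK form_norm_scale; [|by rewrite invr_ge0 ltW|].
  2: exact: retaming_hermitian0.
rewrite bilin_mull (bilinZ _ (J *m G)); field.
by rewrite !gt_eqF // sqrtr_gt0.
Qed.

End Retaming.

End HermitianLinearAlgebra.

(** * Differentiability classes *)

Section DifferentialCongruence.
Variables (R : realType) (V W : normedModType R).
Implicit Types (f g h : V -> W) (x : V).

Lemma near0_differentiable h x :
  (\forall y \near x, h y = 0) -> differentiable h x.
Proof.
move=> h0.
have hx : h x = 0 by exact: nbhs_singleton h0.
have o0 : h \o shift x = cst (h x) + (\0 : {linear V -> W}) +o_ 0 id.
  apply/eqaddoP => e e0; near=> y.
  have hy : h (y + x) = 0.
    by near: y; move: h0; rewrite (near_shift 0 x) subr0.
  by rewrite !fctE /= hx hy addr0 subrr normr0 mulr_ge0 // ltW.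
have c0 : continuous (\0 : {linear V -> W}) by exact: cst_continuous.
have dh : 'd h x = (\0 : {linear V -> W}) :> (V -> W).
  exact: diff_unique c0 o0.
apply/diff_locallyP; rewrite dh; split.
Unshelve. all: by end_near. Qed.

Lemma near_eq_differentiable f g x :
  (\forall y \near x, f y = g y) -> differentiable f x -> differentiable g x.
Proof.
move=> fg df; have -> : g = f + (g - f) by rewrite addrC subrK.
apply: differentiableD df _; apply: near0_differentiable.
by near=> y; rewrite !fctE (near fg y) ?subrr.
Unshelve. all: by end_near. Qed.

End DifferentialCongruence.

Section CkCalculus.
Variables (R : realType) (n : nat) (U : set 'rV[R]_n).
Hypothesis openU : open U.

Lemma Ck_onW (V : normedModType R) k (f : 'rV[R]_n -> V) :
  Ck_on k.+1 U f -> Ck_on k U f.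
Proof.
elim: k f => [|k IHk] f [df Df].
  by move=> x /df/differentiable_continuous.
by split=> // v; apply: IHk (Df v).
Qed.

Lemma Ck_on_eq (V : normedModType R) k (f g : 'rV[R]_n -> V) :
  (forall x, U x -> f x = g x) -> Ck_on k U f -> Ck_on k U g.
Proof.
elim: k f g => [|k IHk] f g fg.
all: have nfg x : U x -> \forall y \near x, f y = g y
  by move=> Ux; apply: filterS fg _; exact: open_nbhs_nbhs.
  move=> cf x Ux; rewrite /prop_for /continuous_at -(fg _ Ux).
  exact: cvg_trans (near_eq_cvg (nfg x Ux)) (cf x Ux).
case=> df Df; split=> [x Ux|v].
  exact: near_eq_differentiable (nfg x Ux) (df x Ux).
apply: IHk (Df v) => x Ux; exact/near_eq_derive/nfg.
Unshelve. all: by end_near. Qed.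

Lemma Ck_on_cst (V : normedModType R) k (a : V) : Ck_on k U (fun=> a).
Proof.
elim: k a => [|k IHk] a /=; first by move=> x _; exact: cst_continuous.
split=> [x _|v]; first exact: differentiable_cst.
by under [X in Ck_on _ _ X]funext do rewrite (derive_cst a).
Qed.

Lemma Ck_onD (V : normedModType R) k (f g : 'rV[R]_n -> V) :
  Ck_on k U f -> Ck_on k U g -> Ck_on k U (fun x => f x + g x).
Proof.
elim: k f g => [|k IHk] f g.
  by move=> cf cg x Ux; exact: cvgD (cf x Ux) (cg x Ux).
move=> [df Df] [dg Dg]; split=> [x Ux|v].
  by apply: differentiableD; [exact: df|exact: dg].
apply: Ck_on_eq (IHk _ _ (Df v) (Dg v)) => x Ux.
by rewrite deriveD //; apply/diff_derivable; [exact: df|exact: dg].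
Qed.

Lemma Ck_onM k (f g : 'rV[R]_n -> R) :
  Ck_on k U f -> Ck_on k U g -> Ck_on k U (fun x => f x * g x).
Proof.
elim: k f g => [|k IHk] f g.
  by move=> cf cg x Ux; exact: cvgM (cf x Ux) (cg x Ux).
move=> /[dup] /Ck_onW Cf [df Df] /[dup] /Ck_onW Cg [dg Dg]; split=> [x Ux|v].
  by apply: differentiableM; [exact: df|exact: dg].
apply: Ck_on_eq (Ck_onD (IHk _ _ Cf (Dg v)) (IHk _ _ Cg (Df v))) => x Ux.
by rewrite deriveM //; apply/diff_derivable; [exact: df|exact: dg].
Qed.

Lemma Ck_onV k (f : 'rV[R]_n -> R) :
  (forall x, U x -> f x != 0) -> Ck_on k U f -> Ck_on k U (fun x => (f x)^-1).
Proof.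
move=> f0; elim: k => [|k IHk].
  by move=> cf x Ux; exact: cvgV (f0 x Ux) (cf x Ux).
move=> /[dup] /Ck_onW /IHk Cf [df Df]; split=> [x Ux|v].
  by apply: differentiableV; [exact: df|exact: f0].
apply: Ck_on_eq
  (Ck_onM (Ck_onM (Ck_on_cst k (-1 : R)) (Ck_onM Cf Cf)) (Df v)) => x Ux.
rewrite deriveV ?f0 //; last exact/diff_derivable/df.
by rewrite mulN1r -expr2 exprVn.
Qed.

Lemma Ck_on_sqrt k (f : 'rV[R]_n -> R) :
  (forall x, U x -> 0 < f x) -> Ck_on k U f ->
  Ck_on k U (fun x => Num.sqrt (f x)).
Proof.
move=> f0; elim: k => [|k IHk].
  move=> cf x Ux; apply: continuous_comp; first exact: cf.
  exact: sqrt_continuous.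
move=> /[dup] /Ck_onW /IHk Cf [df Df].
have ds x : U x -> differentiable (@Num.sqrt R) (f x).
  move=> Ux; apply/derivable1_diffP.
  by have [] := is_derive1_sqrt (f0 x Ux).
split=> [x Ux|v].
  by apply: (@differentiable_comp _ _ _ _ f); [exact: df|exact: ds].
have s0 x : U x -> 2 * Num.sqrt (f x) != 0.
  by move=> Ux; rewrite mulf_neq0 ?pnatr_eq0// gt_eqF// sqrtr_gt0 f0.
apply: Ck_on_eq
  (Ck_onM (Ck_onV s0 (Ck_onM (Ck_on_cst k (2 : R)) Cf)) (Df v)) => x Ux.
rewrite (deriveE _ (differentiable_comp (df x Ux) (ds x Ux))).
rewrite diff_comp; [|exact: df|exact: ds].
rewrite /= (deriveE _ (df x Ux)).
have /deriv1E -> : derivable (@Num.sqrt R) (f x) 1 by exact/derivable1_diffP/ds.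
by rewrite derive1E derive_sqrt ?f0 // mulrC.
Qed.

(** [F] is a finite sum of its entries times constant matrices. *)
Lemma differentiable_mxP (p q : nat) (F : 'rV[R]_n -> 'M[R]_(p, q)) x :
  differentiable F x <->
  (forall i j, differentiable (fun y => F y i j) x).
Proof.
split=> [dF i j|dF].
  exact: differentiable_comp dF (differentiable_coord (F x) i j).
have -> : F = \sum_i \sum_j (fun y => F y i j *: delta_mx i j).
  apply/funext => y; rewrite {1}(matrix_sum_delta (F y)) fct_sumE.
  by apply: eq_bigr => i _; rewrite fct_sumE.
apply: differentiable_sum => i; apply: differentiable_sum => j.
exact: differentiableZl.
Qed.

(** A matrix with entries of class [k.+1] is seen to be of class [k]; the
    loss of one degree is harmless since all degrees are required. *)
Lemma smooth_on_mxP (p q : nat) (F : 'rV[R]_n -> 'M[R]_(p, q)) :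
  smooth_on U F <-> (forall i j, smooth_on U (fun x => F x i j)).
Proof.
have entry k (G : 'rV[R]_n -> 'M[R]_(p, q)) i j :
    Ck_on k U G -> Ck_on k U (fun x => G x i j).
  elim: k G => [|k IHk] G.
    move=> cG x Ux.
    exact: continuous_comp (cG x Ux) (@coord_continuous _ _ _ i j (G x)).
  move=> [dG DG]; split=> [x Ux|v].
    exact: ((differentiable_mxP G x).1 (dG x Ux)).
  apply: Ck_on_eq (IHk _ (DG v)) => x Ux.
  by rewrite derive_mx ?mxE //; exact/diff_derivable/dG.
have mx k (G : 'rV[R]_n -> 'M[R]_(p, q)) :
    (forall i j, Ck_on k.+1 U (fun x => G x i j)) -> Ck_on k U G.
  elim: k G => [|k IHk] G CG;
    have dG x : U x -> differentiable G x by
      move=> Ux; apply/differentiable_mxP => i j; have [+ _] := CG i j; exact.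
    by move=> x /dG/differentiable_continuous.
  split=> // v; apply: IHk => i j.
  have CD : Ck_on k.+1 U ('D_v (fun x => G x i j)) by have [_] := CG i j; exact.
  apply: Ck_on_eq CD => x Ux.
  by rewrite derive_mx ?mxE //; exact/diff_derivable/dG.
by split=> [sF i j k|sF k]; [exact: entry|apply: mx => i j; exact: sF].
Qed.

Lemma smooth_on_eq (V : normedModType R) (f g : 'rV[R]_n -> V) :
  (forall x, U x -> f x = g x) -> smooth_on U f -> smooth_on U g.
Proof. by move=> fg sf k; exact: Ck_on_eq fg (sf k). Qed.

Lemma smooth_on_sum (I : Type) (r : seq I) (f : I -> 'rV[R]_n -> R) :
  (forall i, smooth_on U (f i)) -> smooth_on U (fun x => \sum_(i <- r) f i x).
Proof.
move=> sf k; elim: r => [|i r IHr].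
  by apply: Ck_on_eq (Ck_on_cst k (0 : R)) => x _; rewrite big_nil.
by apply: Ck_on_eq (Ck_onD (sf i k) IHr) => x _; rewrite big_cons.
Qed.

Lemma smooth_on_prod (I : Type) (r : seq I) (f : I -> 'rV[R]_n -> R) :
  (forall i, smooth_on U (f i)) -> smooth_on U (fun x => \prod_(i <- r) f i x).
Proof.
move=> sf k; elim: r => [|i r IHr].
  by apply: Ck_on_eq (Ck_on_cst k (1 : R)) => x _; rewrite big_nil.
by apply: Ck_on_eq (Ck_onM (sf i k) IHr) => x _; rewrite big_cons.
Qed.

Lemma smooth_on_addmx p q (F G : 'rV[R]_n -> 'M[R]_(p, q)) :
  smooth_on U F -> smooth_on U G -> smooth_on U (fun x => F x + G x).
Proof. by move=> sF sG k; exact: Ck_onD (sF k) (sG k). Qed.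

Lemma smooth_on_scalemx p q (f : 'rV[R]_n -> R) (F : 'rV[R]_n -> 'M[R]_(p, q)) :
  smooth_on U f -> smooth_on U F -> smooth_on U (fun x => f x *: F x).
Proof.
move=> sf /smooth_on_mxP sF; apply/smooth_on_mxP => i j k.
by apply: (Ck_on_eq _ (Ck_onM (sf k) (sF i j k))) => x _; rewrite mxE.
Qed.

Lemma smooth_on_trmx p q (F : 'rV[R]_n -> 'M[R]_(p, q)) :
  smooth_on U F -> smooth_on U (fun x => (F x)^T).
Proof.
move=> /smooth_on_mxP sF; apply/smooth_on_mxP => i j k.
by apply: (Ck_on_eq _ (sF j i k)) => x _; rewrite mxE.
Qed.

Lemma smooth_on_mulmx p q r (F : 'rV[R]_n -> 'M[R]_(p, q))
    (G : 'rV[R]_n -> 'M[R]_(q, r)) :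
  smooth_on U F -> smooth_on U G -> smooth_on U (fun x => F x *m G x).
Proof.
move=> /smooth_on_mxP sF /smooth_on_mxP sG; apply/smooth_on_mxP => i j.
have sFG l : smooth_on U (fun x => F x i l * G x l j).
  by move=> k; exact: Ck_onM (sF i l k) (sG l j k).
move=> k; apply: Ck_on_eq (smooth_on_sum (index_enum 'I_q) sFG k) => x _.
by rewrite mxE.
Qed.

Lemma smooth_on_mxtrace p (F : 'rV[R]_n -> 'M[R]_p) :
  smooth_on U F -> smooth_on U (fun x => \tr (F x)).
Proof.
by move=> /smooth_on_mxP sF; apply: smooth_on_sum => i.
Qed.

Lemma smooth_on_det p (F : 'rV[R]_n -> 'M[R]_p) :
  smooth_on U F -> smooth_on U (fun x => \det (F x)).
Proof.
move=> /smooth_on_mxP sF; apply: smooth_on_sum => s k.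
by apply: Ck_onM; [exact: Ck_on_cst|exact: smooth_on_prod].
Qed.

(** Cramer's rule. *)
Lemma smooth_on_invmx p (F : 'rV[R]_n -> 'M[R]_p) :
  (forall x, U x -> F x \in unitmx) ->
  smooth_on U F -> smooth_on U (fun x => invmx (F x)).
Proof.
move=> uF sF; have sdet := smooth_on_det sF.
have sadj : smooth_on U (fun x => \adj (F x)).
  apply/smooth_on_mxP => i j.
  have sminor : smooth_on U (fun x => \det (row' j (col' i (F x)))).
    apply: smooth_on_det; apply/smooth_on_mxP => a b k.
    apply: Ck_on_eq ((smooth_on_mxP _).1 sF (lift j a) (lift i b) k) => x _.
    by rewrite !mxE.
  move=> k; have sgn := Ck_on_cst k ((-1) ^+ (j + i) : R).
  by apply: Ck_on_eq (Ck_onM sgn (sminor k)) => x _; rewrite mxE.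
have sV : smooth_on U (fun x => (\det (F x))^-1).
  by move=> k; apply: Ck_onV => // x /uF; rewrite unitmxE unitfE.
move=> k; apply: Ck_on_eq (smooth_on_scalemx sV sadj k) => x Ux.
by rewrite /invmx uF.
Qed.

End CkCalculus.

(** * Smooth tensor fields *)

(** By the chain rule the Jacobian of [h] at [f x] is a right inverse. *)
Lemma jacobian_unitmx (R : realType) n (f h : 'rV[R]_n -> 'rV[R]_n) x :
  differentiable f x -> differentiable h (f x) ->
  (\forall y \near x, h (f y) = y) -> 'J f x \in unitmx.
Proof.
move=> df dh hf.
have hfE : \forall y \near x, (h \o f) y = id y by exact: hf.
have Dhf v : 'D_v (h \o f) x = v by rewrite (near_eq_derive v hfE) derive_id.
have PQ : 'J f x *m 'J h (f x) = 1%:M.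
  apply/row_matrixP => i; rewrite row_mul !rowE mulmx1.
  rewrite -[RHS]Dhf (deriveE _ (differentiable_comp df dh)) (diff_comp df dh).
  by rewrite /jacobian !mul_rV_lin1.
exact: (mulmx1_unit PQ).1.
Qed.

Section Tensors.
Variables (R : realType) (n : nat) (M : manifold R n).
Implicit Types (c : chart R n M) (p : M).

(** The change of coordinates is smooth with smooth inverse. *)
Lemma coord_frame_unit c p : atlas c -> cdom c p -> coord_frame c p \in unitmx.
Proof.
move=> ac cp; rewrite /coord_frame.
have [ac0 c0p] : atlas (chart_at p) /\ cdom (chart_at p) p.
  by rewrite /chart_at; case: cid2.
set c0 := chart_at p in ac0 c0p *.
set f := cmap c0 \o cinv c; set h := cmap c \o cinv c0; set x := cmap c p.
have fx : f x = cmap c0 p by rewrite /f /= cmapK.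
have df : differentiable f x.
  have [+ _] := atlas_smooth ac ac0 1; apply; split; first exact: cmap_img.
  by rewrite /= cmapK.
have dh : differentiable h (f x).
  rewrite fx; have [+ _] := atlas_smooth ac0 ac 1; apply.
  by split; [exact: cmap_img|rewrite /= cmapK].
have hf : \forall y \near x, h (f y) = y.
  have nc : \forall y \near x, cimg c y.
    by apply: open_nbhs_nbhs; split; [exact: cimg_open|exact: cmap_img].
  have nc0 : \forall y \near x, cdom c0 (cinv c y).
    have := cinv_continuous (cmap_img cp); apply.
    apply: open_nbhs_nbhs; split; first exact: cdom_open.
    by rewrite cmapK.
  by near=> y; rewrite /h /f /= cmapK ?cinvK //; near: y.
exact: jacobian_unitmx df dh hf.
Unshelve. all: by end_near. Qed.

Definition smooth_fun (f : M -> R) : Prop :=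
  forall c, atlas c -> smooth_on (cimg c) (f \o cinv c).

Lemma comp_frame_unit c x :
  atlas c -> cimg c x -> coord_frame c (cinv c x) \in unitmx.
Proof. by move=> ac cx; apply: coord_frame_unit => //; exact: cinv_dom. Qed.

Lemma smooth_fun_cst (a : R) : smooth_fun (fun=> a).
Proof. by move=> c ac k; exact: Ck_on_cst. Qed.

Lemma smooth_funV (f : M -> R) :
  (forall p, f p != 0) -> smooth_fun f -> smooth_fun (fun p => (f p)^-1).
Proof.
move=> f0 sf c ac k; apply: Ck_onV (sf c ac k); first exact: cimg_open.
by move=> x _; exact: f0.
Qed.

Lemma smooth_funM (f g : M -> R) :
  smooth_fun f -> smooth_fun g -> smooth_fun (fun p => f p * g p).
Proof.
by move=> sf sg c ac k; apply: Ck_onM (sf c ac k) (sg c ac k); exact: cimg_open.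
Qed.

Lemma smooth_bilinD (A B : bilin_field M) :
  smooth_bilin A -> smooth_bilin B -> smooth_bilin (fun p => A p + B p).
Proof.
move=> sA sB c ac; have oc : open (cimg c) := @cimg_open _ _ _ c.
apply: (smooth_on_eq oc _ (smooth_on_addmx oc (sA c ac) (sB c ac))) => x cx.
by rewrite /bilin_comp mulmxDr mulmxDl.
Qed.

Lemma smooth_bilinZ (f : M -> R) (B : bilin_field M) :
  smooth_fun f -> smooth_bilin B -> smooth_bilin (fun p => f p *: B p).
Proof.
move=> sf sB c ac; have oc : open (cimg c) := @cimg_open _ _ _ c.
apply: (smooth_on_eq oc _ (smooth_on_scalemx oc (sf c ac) (sB c ac))) => x cx.
by rewrite /bilin_comp -scalemxAr -scalemxAl.
Qed.

Lemma smooth_bilinN (B : bilin_field M) :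
  smooth_bilin B -> smooth_bilin (fun p => - B p).
Proof.
move=> sB; have := smooth_bilinZ (smooth_fun_cst (-1)) sB.
by under eq_fun do rewrite scaleN1r.
Qed.

Lemma smooth_bilin_tr (B : bilin_field M) :
  smooth_bilin B -> smooth_bilin (fun p => (B p)^T).
Proof.
move=> sB c ac; have oc : open (cimg c) := @cimg_open _ _ _ c.
apply: (smooth_on_eq oc _ (smooth_on_trmx oc (sB c ac))) => x cx.
by rewrite /bilin_comp !trmx_mul trmxK mulmxA.
Qed.

Lemma smooth_bilin_mul (A : endo_field M) (B : bilin_field M) :
  smooth_endo A -> smooth_bilin B -> smooth_bilin (fun p => A p *m B p).
Proof.
move=> sA sB c ac; have oc : open (cimg c) := @cimg_open _ _ _ c.
apply: (smooth_on_eq oc _ (smooth_on_mulmx oc (sA c ac) (sB c ac))) => x cx.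
by rewrite /endo_comp /bilin_comp !mulmxA mulmxKV // comp_frame_unit.
Qed.

Lemma smooth_endoZ (f : M -> R) (A : endo_field M) :
  smooth_fun f -> smooth_endo A -> smooth_endo (fun p => f p *: A p).
Proof.
move=> sf sA c ac; have oc : open (cimg c) := @cimg_open _ _ _ c.
apply: (smooth_on_eq oc _ (smooth_on_scalemx oc (sf c ac) (sA c ac))) => x cx.
by rewrite /endo_comp -scalemxAr -scalemxAl.
Qed.

Lemma invmx_congr (P B : 'M[R]_n) : P \in unitmx -> B \in unitmx ->
  invmx (P *m B *m P^T) = (invmx P)^T *m invmx B *m invmx P.
Proof.
move=> PU BU; have PBU : P *m B *m P^T \in unitmx.
  by rewrite !unitmx_mul unitmx_tr PU BU.
apply: (can_inj (mulKmx PBU)); rewrite mulmxV // !mulmxA trmx_inv.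
by rewrite mulmxK ?unitmx_tr // mulmxK // mulmxV.
Qed.

Lemma bilin_comp_unit (g : bilin_field M) c x : (forall p, g p \in unitmx) ->
  atlas c -> cimg c x -> bilin_comp g c x \in unitmx.
Proof.
by move=> gU ac cx; rewrite !unitmx_mul unitmx_tr gU (comp_frame_unit ac cx).
Qed.

Lemma smooth_endo_of_bilin (g B : bilin_field M) : (forall p, g p \in unitmx) ->
  smooth_bilin g -> smooth_bilin B -> smooth_endo (fun p => B p *m invmx (g p)).
Proof.
move=> gU sg sB c ac; have oc : open (cimg c) := @cimg_open _ _ _ c.
have sV : smooth_on (cimg c) (fun x => invmx (bilin_comp g c x)).
  by apply: smooth_on_invmx (sg c ac) => // x; exact: bilin_comp_unit.
apply: (smooth_on_eq oc _ (smooth_on_mulmx oc (sB c ac) sV)) => x cx.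
have PU := comp_frame_unit ac cx.
rewrite /endo_comp /bilin_comp /= invmx_congr // !mulmxA trmx_inv.
by rewrite mulmxK ?unitmx_tr.
Qed.

(** The norm does not depend on the frame: the frame matrices cancel inside the
    trace. *)
Lemma form_norm_congr (P B a : 'M[R]_n) : P \in unitmx -> B \in unitmx ->
  form_norm (P *m B *m P^T) (P *m a *m P^T) = form_norm B a.
Proof.
move=> PU BU; rewrite /form_norm invmx_congr // !trmx_mul trmxK trmx_inv.
congr (Num.sqrt (_ * _)); rewrite !mulmxA !(mulmxKV PU).
rewrite mulmxK ?unitmx_tr // mxtrace_mulC !mulmxA.
by rewrite mulmxV ?unitmx_tr // mul1mx.
Qed.

Lemma smooth_form_norm (g a : bilin_field M) : (forall p, g p \in unitmx) ->
  smooth_bilin g -> smooth_bilin a -> (forall p, 0 < form_norm (g p) (a p)) ->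
  smooth_fun (fun p => form_norm (g p) (a p)).
Proof.
move=> gU sg sa n0 c ac; have oc : open (cimg c) := @cimg_open _ _ _ c.
have normE x : cimg c x -> form_norm (bilin_comp g c x) (bilin_comp a c x) =
    form_norm (g (cinv c x)) (a (cinv c x)).
  by move=> cx; apply: form_norm_congr => //; exact: comp_frame_unit.
have sV : smooth_on (cimg c) (fun x => invmx (bilin_comp g c x)).
  by apply: smooth_on_invmx (sg c ac) => // x; exact: bilin_comp_unit.
apply: (smooth_on_eq oc normE) => k; apply: Ck_on_sqrt => // [x cx|].
  by have := n0 (cinv c x); rewrite -normE // sqrtr_gt0.
apply: Ck_onM => //; first exact: Ck_on_cst.
by apply: smooth_on_mxtrace => //; do 3?[apply: smooth_on_mulmx => //];
  [exact: sa|exact/smooth_on_trmx/sa].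
Qed.

End Tensors.

(** * Tamed structures and the structures [Jt] *)

Section TildeFields.
Variables (R : realType) (M : manifold R 4) (g w : bilin_field M).
Hypotheses (gU : forall p, g p \in unitmx).
Hypotheses (n0 : forall p, 0 < form_norm (g p) (w p)).
Hypotheses (sg : smooth_bilin g) (sw : smooth_bilin w).

Lemma smooth_tilde_factor : smooth_fun (fun p => tilde_factor (g p) (w p)).
Proof.
apply: smooth_funM; first exact: smooth_fun_cst.
apply: smooth_funV; first by move=> p; rewrite gt_eqF.
exact: smooth_form_norm.
Qed.

Lemma smooth_tilde_endo : smooth_endo (fun p => tilde_endo (g p) (w p)).
Proof.
apply: smooth_endoZ smooth_tilde_factor _; exact: smooth_endo_of_bilin.
Qed.

End TildeFields.

Lemma almost_hermitian_at (R : realType) n (M : manifold R n)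
    (g w : bilin_field M) (J : endo_field M) (p : M) :
  almost_hermitian g J w -> hermitian_at (g p) (J p) /\ w p = J p *m g p.
Proof.
move=> [[_ JJ] [_ gC gpos] gJ _ wE]; split; [split|].
- by apply: bilin_inj => u v; rewrite bilin_tr gC.
- exact: gpos.
- by apply/row_matrixP => i; rewrite !rowE mulmxA JJ mulmxN mulmx1.
- by apply: bilin_inj => u v; rewrite -bilin_mul gJ.
- by apply: bilin_inj => u v; rewrite wE bilin_mull.
Qed.

Lemma anti_invariant_at (R : realType) n (M : manifold R n)
    (J : endo_field M) (a : bilin_field M) (p : M) :
  anti_invariant J a -> anti_herm (J p) (a p).
Proof.
move=> [[_ a0] aJ]; split; first exact/alternatingP.
by apply: bilin_inj => u v; rewrite -bilin_mul aJ bilinN.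
Qed.

Lemma tames_nondegenerate (R : realType) n (M : manifold R n)
    (w : bilin_field M) (J : endo_field M) :
  tames w J -> forall (p : M) (u : 'rV[R]_n),
  (forall v, bilin (w p) u v = 0) -> u = 0.
Proof.
move=> wJ p u wu0; apply: contraTeq isT => /(wJ p).
by rewrite wu0 ltxx.
Qed.

Lemma tilde_J_unique (R : realType) (M : manifold R 4)
    (g w a : bilin_field M) (Jt : endo_field M) (p : M) :
  g p \in unitmx -> is_tilde_J g w a Jt ->
  Jt p = tilde_endo (g p) (w p + a p).
Proof.
move=> gU JtE; apply: (can_inj (mulmxK gU)); rewrite tilde_endo_mul //.
by apply: bilin_inj => u v; rewrite -bilin_mull JtE bilinZ.
Qed.

(** The form [w] tames [Jt], and taming makes it nondegenerate. *)
Lemma tilde_J_tamed (R : realType) (M : manifold R 4) (g w a : bilin_field M)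
    (J Jt : endo_field M) :
  almost_kahler g J w -> anti_invariant J a -> is_tilde_J g w a Jt ->
  [/\ almost_complex Jt, symplectic w & tames w Jt].
Proof.
move=> [gJw dw] aJ JtE.
have Hp p := (almost_hermitian_at p gJw).1.
have wE p := (almost_hermitian_at p gJw).2.
have ap p := anti_invariant_at p aJ.
have gU p : g p \in unitmx := posdef_unit (herm_pos (Hp p)).
have JtpE p : Jt p = tilde_endo (g p) (J p *m g p + a p).
  by rewrite -wE; exact: tilde_J_unique.
have wJt : tames w Jt.
  by move=> p u u0; rewrite wE JtpE; exact: fundamental_tames.
have [_ [sg _ _] _ [sw w0] _] := gJw.
split=> //; last by split=> //; exact: tames_nondegenerate wJt.
split=> [|p u]; last first.
  rewrite -mulmxA JtpE (herm_sqr (tilde_hermitian (Hp p) (ap p))).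
  by rewrite mulmxN mulmx1.
have -> : Jt = fun p => tilde_endo (g p) (w p + a p).
  by apply/funext => p; rewrite JtpE wE.
apply: smooth_tilde_endo => // [p|].
  by rewrite wE; exact: tilde_norm_gt0 (Hp p) (ap p).
by apply: smooth_bilinD => //; case: aJ => -[].
Qed.

(** The form [w] is kept; the metric is rescaled by [c^-1] so that [w] becomes
    the fundamental form of the new structure [T]. *)
Lemma tamed_is_tilde_J (R : realType) (M : manifold R 4) (J : endo_field M)
    (w : bilin_field M) :
  almost_complex J -> symplectic w -> tames w J ->
  exists (g : bilin_field M) (T : endo_field M) (a : bilin_field M),
  [/\ almost_kahler g T w, anti_invariant T a & is_tilde_J g w a J].
Proof.
move=> [sJ JJ0] [[sw w0] dw _] wJ.
have JJ p : J p *m J p = - 1%:M.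
  by apply/row_matrixP => i; rewrite !rowE mulmxA JJ0 mulmxN mulmx1.
have wT p : (w p)^T = - w p by exact/alternatingP.
pose g0 p := taming_metric (J p) (w p).
have H0 p : hermitian_at (g0 p) (J p).
  exact: taming_metric_hermitian (JJ p) (wT p) (wJ p).
have g0U p : g0 p \in unitmx := posdef_unit (herm_pos (H0 p)).
pose c p := tilde_factor (g0 p) (w p).
have c0 p : 0 < c p := retaming_factor_gt0 (JJ p) (wT p) (wJ p).
pose g p := (c p)^-1 *: g0 p.
pose T p := tilde_endo (g0 p) (w p).
pose a p := (c p)^-1 *: (J p *m g p) - w p.
have HT p : hermitian_at (g p) (T p) := retaming_hermitian (JJ p) (wT p) (wJ p).
have TaT p : anti_herm (T p) (a p) := retaming_anti_herm (JJ p) (wT p) (wJ p).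
have n0 p : 0 < form_norm (g0 p) (w p).
  rewrite -invr_gt0 -(pmulr_rgt0 _ (x := Num.sqrt 2)) ?sqrtr_gt0 //.
  exact: c0.
have sg0 : smooth_bilin (g0 : bilin_field M).
  apply: smooth_bilinZ; first exact: smooth_fun_cst.
  apply: smooth_bilinD; last exact/smooth_bilinN/smooth_bilin_mul.
  have := smooth_bilin_tr (smooth_bilin_mul sJ (smooth_bilin_tr sw)).
  by under eq_fun do rewrite trmx_mul trmxK.
have sc : smooth_fun (fun p => (c p)^-1).
  apply: smooth_funV; first by move=> p; rewrite gt_eqF.
  exact: smooth_tilde_factor.
have sg : smooth_bilin (g : bilin_field M) by exact: smooth_bilinZ.
have sa : smooth_bilin (a : bilin_field M).
  apply: smooth_bilinD; last exact: smooth_bilinN.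
  by apply: smooth_bilinZ => //; exact: smooth_bilin_mul.
exists g, T, a; split.
- split=> //; split=> //.
  + split=> [|p u]; first exact: smooth_tilde_endo.
    by rewrite -mulmxA (herm_sqr (HT p)) mulmxN mulmx1.
  + split=> // [p u v|p]; last exact: herm_pos (HT p).
    by rewrite -[in LHS](herm_sym (HT p)) bilin_tr.
  + by move=> p u v; rewrite bilin_mul (herm_iso (HT p)).
  + move=> p u v; rewrite bilin_mull.
    by rewrite (retaming_fundamental (JJ p) (wT p) (wJ p)).
- split=> [|p u v]; last by rewrite bilin_mul (TaT p).2 bilinN.
  by split=> // p; apply/alternatingP; exact: (TaT p).1.
- by move=> p u v; exact: retaming_tilde (JJ p) (wT p) (wJ p) u v.
Qed.

Theorem mainTheorem5 (R : realType) :
  (forall M : manifold R 4, compact [set: M] ->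
   forall J : endo_field M, almost_complex J ->
   (exists w : bilin_field M, symplectic w /\ tames w J) ->
   exists w : bilin_field M, symplectic w /\ compatible w J)
  <->
  (forall M : manifold R 4, compact [set: M] ->
   forall (g : bilin_field M) (J : endo_field M) (w : bilin_field M),
   almost_kahler g J w ->
   forall a : bilin_field M, anti_invariant J a ->
   forall Jt : endo_field M, is_tilde_J g w a Jt ->
   exists s : bilin_field M, symplectic s /\ compatible s Jt).
Proof.
split=> [A M cM g J w gJw a aJ Jt JtE|B M cM J acJ [w [sw wJ]]].
  have [acJt sw wJt] := tilde_J_tamed gJw aJ JtE.
  by apply: (A M cM Jt acJt); exists w.
have [g [T [a [gTw aT JE]]]] := tamed_is_tilde_J acJ sw wJ.
exact: (B M cM g T w gTw a aT J JE).
Qed.
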